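(* Every finite group $G$ with $\alpha(G)=\alpha(Z(G))$ is $2$-central.
   Context: For a finite group $H$, $C(H)$ denotes the set of cyclic subgroups of $H$ and $\alpha(H)=\frac{|C(H)|}{|H|}$. $Z(G)$ denotes the center of $G$. For a positive integer $n$, a group $G$ is called $n$-central if $x^n\in Z(G)$ for all $x\in G$ (equivalently, the exponent of $G/Z(G)$ divides $n$). *)

(* Defs.v *)
From mathcomp Require Import all_boot all_order all_algebra all_fingroup all_solvable.

Set Implicit Arguments.
Unset Strict Implicit.
Unset Printing Implicit Defensive.

Import GroupScope GRing.Theory.

Definition cyclic_subgroups (gT : finGroupType) (H : {group gT}) :
    {set {group gT}} :=
  [set C in subgroups H | cyclic C].

Definition alpha (gT : finGroupType) (H : {group gT}) : rat :=
  (#|cyclic_subgroups H|%:R / #|H|%:R)%R.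

Definition n_central (n : nat) (gT : finGroupType) (G : {group gT}) : Prop :=
  forall x : gT, x \in G -> x ^+ n \in 'Z(G).

(* Main.v *)
Require Import Defs.
From mathcomp Require Import all_boot all_order all_algebra all_fingroup all_solvable.

Import GRing.Theory Num.Theory GroupScope.

(** Weighting each element [x] by [1 / totient #[x]] counts cyclic subgroups,
    because a cyclic group of order [n] has [totient n] generators
    ([card_cyclic_subgroups]). So [alpha G] is the average weight over [G], and
    it is also the average over [x] in [G] of the average weight of the coset
    [x * 'Z(G)].

    No coset of the center is heavier than the center itself. Indeed, let [y]
    have least order in its coset; then [#[z]] divides [#[y * z]] for every
    central [z] ([order_dvd_min_coset]), so [y * z] weighs at most as much as
    [z]. If [alpha G = alpha 'Z(G)], none of these inequalities is strict. The
    case [z = 1] gives [totient #[y] = 1], hence [y ^+ 2 = 1], and every element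
    of the coset of [y] has a central square. *)

Local Notation weight x := ((totient #[x])%:R^-1 : rat)%R.

(** The elements generating a given cyclic subgroup [C] number [totient #|C|]
    and have order [#|C|], so their weights add up to 1. *)
Lemma card_cyclic_subgroups (gT : finGroupType) (H : {group gT}) :
  (#|cyclic_subgroups H|%:R = \sum_(x in H) weight x)%R.
Proof.
rewrite (partition_big (fun x => <[x]>%G) (mem (cyclic_subgroups H))) /=; last first.
  by move=> x Hx; rewrite !inE cycle_subG Hx cycle_cyclic.
rewrite -sumr_const; apply: eq_bigr => C /[!inE] /andP[sCH /cyclicP[a defC]].
have genE x : (x \in H) && (<[x]>%G == C) = (x \in [set u | generator <[a]> u]).
  rewrite inE /generator -defC -val_eqE /= [RHS]eq_sym.
  case: eqP => [eqC|_]; last by rewrite andbF.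
  by rewrite andbT (subsetP sCH) // -eqC cycle_id.
rewrite (eq_bigl _ _ genE) (eq_bigr (fun _ => weight a)) => [|x].
  rewrite sumr_const -totient_gen -[RHS]mulr_natr mulVf //.
  by rewrite pnatr_eq0 -lt0n totient_gt0 order_gt0.
by rewrite inE /generator => /eqP eqC; rewrite /order eqC.
Qed.

(** Work one prime [p] at a time. Multiplying [y] by the [p]-constituent of [z]
    changes only the [p]-part of the order, so minimality bounds the [p]-part of
    [#[y]] by that of [#[y * z]]. Both being powers of [p], the first divides the
    second, and [#[y * z]`_p] kills the [p]-constituents of [y] and [y * z],
    hence that of [z]. *)
Lemma order_dvd_min_coset (gT : finGroupType) (Z : {group gT}) (y : gT) :
    y \in 'C(Z) -> {in Z, forall z, #[y] <= #[y * z]} ->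
  {in Z, forall z, #[z] %| #[y * z]}.
Proof.
move=> cZy min_y z Zz; apply/dvdn_partP => [|p]; first exact: order_gt0.
rewrite mem_primes => /andP[p_pr _].
have cyz u : u \in Z -> commute y u by move=> Zu; exact: (centP cZy).
set w := z.`_p; have Zw : w \in Z by rewrite groupX.
have cyw := cyz _ Zw.
have pw : p.-elt w by exact: p_elt_constt.
have yw_p : (y * w).`_p = (y * z).`_p.
  by rewrite !consttM ?(constt_p_elt pw) //; exact: cyz.
have yw_p' : (y * w).`_p^' = y.`_p^'.
  rewrite consttM // (_ : w.`_p^' = 1) ?mulg1 //.
  by apply/constt1P; rewrite p_eltNK.
have le_p : #[y]`_p <= #[y * z]`_p.
  have := min_y _ Zw.
  rewrite -{1}(partnC p (order_gt0 y)) -(partnC p (order_gt0 (y * w))).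
  rewrite -(order_constt p (y * w)) -(order_constt p^' (y * w)) yw_p yw_p'.
  by rewrite !order_constt leq_pmul2r ?part_gt0.
have dv_p : #[y]`_p %| #[y * z]`_p.
  rewrite !p_part in le_p *.
  by rewrite dvdn_exp2l // -(leq_exp2l _ _ (prime_gt1 p_pr)).
apply: dvdn_trans (dvdn_part p _); rewrite -order_constt -/w order_dvdn.
have defyz : (y * z).`_p = y.`_p * w by apply: consttM; exact: cyz.
have : (y * z).`_p ^+ #[y * z]`_p = 1.
  by apply/eqP; rewrite -order_dvdn order_constt.
rewrite defyz expgMn; last by apply/commute_sym/commuteX/commute_sym.
suff /eqP-> : y.`_p ^+ #[y * z]`_p == 1 by rewrite mul1g => ->.
by rewrite -order_dvdn order_constt.
Qed.

(** In Euler's product formula, passing from [d] to a multiple [n] adds prime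
    factors and raises exponents. *)
Lemma leq_totient_dvd d n : 0 < n -> d %| n -> totient d <= totient n.
Proof.
move=> n_gt0 dv_dn; have d_gt0 := dvdn_gt0 n_gt0 dv_dn.
rewrite !totientE //.
have /(perm_big _)-> : perm_eq (primes d) [seq p <- primes n | p %| d].
  apply: uniq_perm; rewrite ?filter_uniq ?primes_uniq // => p.
  rewrite mem_filter !mem_primes n_gt0 d_gt0 /=.
  case p_dv: (p %| d); rewrite ?andbF //=.
  by rewrite (dvdn_trans p_dv dv_dn).
rewrite big_filter big_mkcond /= !big_seq; apply: leq_prod => p.
rewrite mem_primes => /and3P[p_pr _ _].
have p1_gt0 : 0 < p.-1 by rewrite -subn1 subn_gt0 prime_gt1.
case: ifP => _; last by rewrite muln_gt0 p1_gt0 expn_gt0 prime_gt0.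
rewrite leq_pmul2l // leq_exp2l ?prime_gt1 // -!subn1 leq_sub2r //.
exact: dvdn_leq_log.
Qed.

Lemma weight_le (gT : finGroupType) (x y : gT) :
  #[x] %| #[y] -> (weight y <= weight x)%R.
Proof.
move=> dv_xy; have t_gt0 (u : gT) : 0 < totient #[u].
  by rewrite totient_gt0 order_gt0.
rewrite lef_pV2 ?posrE ?ltr0n //.
rewrite ler_nat.
by apply: leq_totient_dvd; rewrite ?order_gt0.
Qed.

Lemma expg2_totient1 (gT : finGroupType) (x : gT) : totient #[x] = 1%N -> x ^+ 2 = 1.
Proof.
move=> tx1; apply/eqP; rewrite -order_dvdn.
have : #[x] <= 2 by rewrite leqNgt -totient_gt1 tx1.
by have := order_gt0 x; case: #[x] => [|[|[]]].
Qed.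

Theorem corollary2 (gT : finGroupType) (G : {group gT}) :
  alpha G = alpha 'Z(G)%G -> n_central 2 G.
Proof.
set Z := 'Z(G)%G => eq_alpha x Gx.
have sZG : Z \subset G by exact: center_sub.
have sGC : G \subset 'C(Z) by rewrite centsC subsetIr.
(* How much lighter the coset [u * Z] is than [Z]; summed over [G], this is
   [#|G|] times the weight of [Z] minus [#|Z|] times the weight of [G]. *)
pose excess u : rat := (\sum_(z in Z) (weight z - weight (u * z)))%R.
have excess_coset u z0 : z0 \in Z -> excess (u * z0) = excess u.
  move=> Zz0; rewrite /excess !sumrB; congr (_ - _)%R.
  rewrite [RHS](reindex_inj (mulgI z0)) /=.
  by apply: eq_big => [z|z _]; rewrite ?groupMl ?mulgA.
have min_coset u : u \in G -> exists2 z0, z0 \in Z &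
    {in Z, forall z, (weight (u * z0 * z) <= weight z)%R}.
  move=> Gu; case: (arg_minnP (fun z => #[u * z]) (group1 Z)) => z0 Zz0 min_z0.
  exists z0 => // z Zz; apply: weight_le.
  apply: (@order_dvd_min_coset _ Z) => // [|z' Zz'].
    by rewrite (subsetP sGC) ?groupM // (subsetP sZG).
  by rewrite -mulgA; apply: min_z0; exact: groupM.
have excess_ge0 u : u \in G -> (0 <= excess u)%R.
  move=> Gu; have [z0 Zz0 le_z0] := min_coset u Gu.
  rewrite -(excess_coset u z0 Zz0).
  by apply: sumr_ge0 => z Zz; rewrite subr_ge0 le_z0.
have sum_excess : (\sum_(u in G) excess u = 0)%R.
  rewrite /excess; under eq_bigr => u _ do rewrite sumrB.
  have sum_coset : (\sum_(u in G) \sum_(z in Z) weight (u * z)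
                    = #|cyclic_subgroups G|%:R *+ #|Z|)%R.
    rewrite exchange_big -sumr_const; apply: eq_bigr => z Zz.
    rewrite card_cyclic_subgroups [RHS](reindex_inj (mulIg z)) /=.
    by apply: eq_bigl => u; rewrite groupMr // (subsetP sZG).
  rewrite sumrB sum_coset sumr_const -card_cyclic_subgroups.
  move: eq_alpha; rewrite /alpha -/Z => /eqP.
  rewrite eqr_div ?pnatr_eq0 -?lt0n ?cardG_gt0 //.
  by rewrite !mulr_natr => /eqP->; rewrite subrr.
have [z0 Zz0 le_z0] := min_coset x Gx; set y := x * z0 in le_z0.
have Gy : y \in G by rewrite groupM // (subsetP sZG).
have excess_y : excess y = 0%R.
  exact: (psumr_eq0P excess_ge0 sum_excess).
have y2 : y ^+ 2 = 1.
  apply: expg2_totient1.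
  have term_ge0 z : z \in Z -> (0 <= weight z - weight (y * z))%R.
    by move=> Zz; rewrite subr_ge0 le_z0.
  have := psumr_eq0P term_ge0 excess_y (group1 Z).
  (* The term [z = 1] compares [weight y] with [weight 1 = 1]. *)
  rewrite mulg1 order1 => /eqP; rewrite subr_eq0 invr1 eq_sym.
  by rewrite invr_eq1 pnatr_eq1 => /eqP.
have cxz0 : commute x z0 by exact: (centP (subsetP sGC x Gx)).
by rewrite -/Z -(groupMr _ (groupX 2 Zz0)) -expgMn // -/y y2 group1.
Qed.
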